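(* Let $\mathcal{H}$ be a real Hilbert space, $C\subseteq\mathcal{H}$ nonempty, closed and convex, and $F:\mathcal{H}\to\mathcal{H}$ a mapping such that: (1) the solution set $SOL(C,F)=\{x^*\in C : \langle F(x^* ),x-x^*\rangle\ge 0 \text{ for all } x\in C\}$ is nonempty; (2) $F$ is monotone on $\mathcal{H}$: $\langle F(x)-F(y),x-y\rangle\ge 0$ for all $x,y\in\mathcal{H}$; (3) $F$ is Lipschitz continuous on $\mathcal{H}$ with constant $L>0$: $\|F(x)-F(y)\|\le L\|x-y\|$ for all $x,y\in\mathcal{H}$. Let $\{v^k\}_{k=0}^\infty$ be a bounded sequence in $\mathcal{H}$ and let $\{\lambda_k\}_{k=0}^\infty$ be scalars with $\lambda_k\ge 0$ for all $k\ge 0$ and $\sum_{k=0}^\infty\lambda_k<+\infty$. Then the sequence $\{x^k\}_{k=0}^\infty$ generated by the subgradient extragradient method with bounded perturbations (described in the context) converges weakly to a solution of the variational inequality, i.e. to a point of $SOL(C,F)$.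
   Context: $P_D$ denotes the metric projection of $\mathcal{H}$ onto a nonempty closed convex set $D$. Subgradient extragradient method with bounded perturbations. Fix $\sigma>0$, $\rho\in(0,1)$, $\mu\in(0,1)$. Start from any $x^0\in\mathcal{H}$ and, for $k\ge 0$, put $z^k=x^k+\lambda_kv^k$ and $$y^k=P_C\big(z^k-\gamma_kF(z^k)\big),$$ $$T(z^k)=\{w\in\mathcal{H} : \langle (z^k-\gamma_kF(z^k))-y^k,\,w-y^k\rangle\le 0\},$$ $$x^{k+1}=P_{T(z^k)}\big(z^k-\gamma_kF(y^k)\big),$$ where $\gamma_k=\sigma\rho^{m_k}$ and $m_k$ is the smallest nonnegative integer such that (with $y^k$ computed using this $\gamma_k$) $$\gamma_k\|F(z^k)-F(y^k)\|\le\mu\big(\|x^k-y^k\|+\lambda_k\|v^k\|\big).$$ *)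

(* Defs.v *)
From HB Require Import structures.
From mathcomp Require Import all_boot all_order all_algebra.
From mathcomp Require Import all_classical all_reals all_analysis.

Set Implicit Arguments.
Unset Strict Implicit.
Unset Printing Implicit Defensive.

Import Order.TTheory GRing.Theory Num.Theory.
Import numFieldNormedType.Exports.

Local Open Scope classical_set_scope.
Local Open Scope ring_scope.

(* A real Hilbert space is a complete normed module [H] over [R] together with
   a symmetric positive definite bilinear form [ip : {dot H for idfun}] that
   induces the norm of [H]. *)
Definition induces_norm (R : realType) (H : normedModType R)
    (ip : {dot H for idfun}) : Prop :=
  forall u : H, `|u| ^+ 2 = ip u u.

Definition monotone_map (R : realType) (H : normedModType R)
    (ip : {dot H for idfun}) (F : H -> H) : Prop :=
  forall x y : H, 0 <= ip (F x - F y) (x - y).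

Definition SOL (R : realType) (H : normedModType R)
    (ip : {dot H for idfun}) (C : set H) (F : H -> H) : set H :=
  [set p | C p /\ forall x, C x -> 0 <= ip (F p) (x - p)].

(* The nearest point of [D] to [u]; it exists and is unique when [D] is a
   nonempty closed convex subset of a Hilbert space, so the default value [u]
   of [xget] is then irrelevant. *)
Definition metric_proj (R : realType) (H : normedModType R)
    (D : set H) (u : H) : H :=
  xget u [set p | D p /\ forall w, D w -> `|u - p| <= `|u - w|].

Definition extragrad_y (R : realType) (H : normedModType R)
    (C : set H) (F : H -> H) (z : H) (gamma : R) : H :=
  metric_proj C (z - gamma *: F z).

Definition subgrad_halfspace (R : realType) (H : normedModType R)
    (ip : {dot H for idfun}) (C : set H) (F : H -> H) (z : H) (gamma : R) :
    set H :=
  let y := extragrad_y C F z gamma in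
  [set w | ip ((z - gamma *: F z) - y) (w - y) <= 0].

Definition linesearch_test (R : realType) (H : normedModType R)
    (C : set H) (F : H -> H) (mu : R) (x v : H) (lambda gamma : R) : Prop :=
  let z := x + lambda *: v in
  let y := extragrad_y C F z gamma in
  gamma * `|F z - F y| <= mu * (`|x - y| + lambda * `|v|).

Definition perturbed_subgrad_extragrad_step (R : realType)
    (H : normedModType R) (ip : {dot H for idfun}) (C : set H) (F : H -> H)
    (sigma rho mu : R) (x v : H) (lambda : R) (xnext : H) : Prop :=
  exists m : nat,
    [/\ linesearch_test C F mu x v lambda (sigma * rho ^+ m),
        forall n : nat,
          linesearch_test C F mu x v lambda (sigma * rho ^+ n) -> (m <= n)%N
      & let gamma := sigma * rho ^+ m in
        let z := x + lambda *: v in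
        let y := extragrad_y C F z gamma in
        xnext =
          metric_proj (subgrad_halfspace ip C F z gamma) (z - gamma *: F y)].

(* Convergence in the weak topology of [H], i.e. against every continuous
   linear functional. *)
Definition weakly_cvg (R : realType) (H : normedModType R)
    (x : nat -> H) (p : H) : Prop :=
  forall f : {linear H -> R^o}, continuous f -> f (x k) @[k --> \oo] --> f p.

(* Main.v *)
Require Import Defs.
From HB Require Import structures.
From mathcomp Require Import all_boot all_order all_algebra.
From mathcomp Require Import all_classical all_reals all_analysis.
From mathcomp Require Import ring lra.

Set Implicit Arguments.
Unset Strict Implicit.
Unset Printing Implicit Defensive.

Import Order.TTheory GRing.Theory Num.Theory.
Import numFieldNormedType.Exports.

Local Open Scope classical_set_scope.
Local Open Scope ring_scope.

(* Let [e_k = lambda_k |v^k|] and [p] in [SOL]. The projection onto the half-space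
   gives |x^(k+1) - p|^2 + (1 - mu) |z^k - y^k|^2
         <= (|x^k - p| + e_k)^2 + 4 e_k^2 / (1 - mu),
   so, [e_k] being summable, [|x^k - p|] converges for every solution [p]
   (quasi-Fejer monotonicity) and [|z^k - y^k|] tends to 0. The step sizes are
   bounded below, because every step size at most [mu / L] passes the test. Hence
   any weak limit of [x] along an ultrafilter satisfies Minty's inequality and
   solves the problem; Opial's argument shows that this limit does not depend on
   the ultrafilter, which is weak convergence. *)

(** If [a] were positive, [t = min(1, a / (2 b))] would give [a <= a / 2]. This replaces letting [t]
    tend to 0 in first-order arguments along segments. *)
Lemma le0_of_le_scale (R : realFieldType) (a b : R) :
  (forall t, 0 < t -> t <= 1 -> a <= t * b) -> a <= 0.
Proof.
move=> h; rewrite leNgt; apply/negP => a0.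
have b0 : 0 < b by have := h 1 ltr01 (lexx _); lra.
have t0 : 0 < Num.min 1 (a / (2 * b)) by rewrite lt_min ltr01 divr_gt0 ?mulr_gt0.
have t1 : Num.min 1 (a / (2 * b)) <= 1 by rewrite ge_min lexx.
have := h _ t0 t1.
have : Num.min 1 (a / (2 * b)) * b <= a / (2 * b) * b.
  by rewrite ler_pM2r // ge_min lexx orbT.
have -> : a / (2 * b) * b = a / 2 by field; rewrite gt_eqF.
lra.
Qed.

(** * Inner product calculus and the variational inequality of nearest points *)

Section InnerProduct.
Variables (R : realType) (H : normedModType R) (ip : {dot H for idfun}).
Hypothesis ipE : induces_norm ip.
Implicit Types (u v w : H) (a : R).

Lemma ipC u v : ip u v = ip v u.
Proof. by rewrite (@hermC _ _ _ _ ip) expr0 mul1r. Qed.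

Lemma ipDl u v w : ip (u + v) w = ip u w + ip v w.
Proof. by rewrite linearDl. Qed.

Lemma ipNl u v : ip (- u) v = - ip u v.
Proof. by rewrite linearNl. Qed.

Lemma ipZl a u v : ip (a *: u) v = a * ip u v.
Proof. by rewrite linearZl. Qed.

Lemma ipDr u v w : ip u (v + w) = ip u v + ip u w.
Proof. by rewrite linearDr. Qed.

Lemma ipNr u v : ip u (- v) = - ip u v.
Proof. by rewrite linearNr. Qed.

Lemma ipZr a u v : ip u (a *: v) = a * ip u v.
Proof. by rewrite linearZr. Qed.

Definition ip_linE := (ipDl, ipNl, ipZl, ipDr, ipNr, ipZr).

Lemma sqr_normD u v : `|u + v| ^+ 2 = `|u| ^+ 2 + 2 * ip u v + `|v| ^+ 2.
Proof. by rewrite !ipE !ip_linE (ipC v u); ring. Qed.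

Lemma sqr_normB u v : `|u - v| ^+ 2 = `|u| ^+ 2 - 2 * ip u v + `|v| ^+ 2.
Proof. by rewrite !ipE !ip_linE (ipC v u); ring. Qed.

(** Cauchy-Schwarz is read off from the triangle inequality of the given norm, by squaring and
    cancelling. *)
Lemma ip_le_norm u v : ip u v <= `|u| * `|v|.
Proof.
have : `|u + v| ^+ 2 <= (`|u| + `|v|) ^+ 2.
  by rewrite lerXn2r ?nnegrE ?addr_ge0 ?ler_normD.
rewrite sqr_normD; nra.
Qed.

Lemma norm_ip_le u v : `|ip u v| <= `|u| * `|v|.
Proof.
by rewrite ler_norml ip_le_norm andbT -lerN2 opprK -ipNl -(normrN u) ip_le_norm.
Qed.

Lemma ip_eq0_norm u : ip u u = 0 -> u = 0.
Proof. by rewrite -ipE => /eqP; rewrite sqrf_eq0 normr_eq0 => /eqP. Qed.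

Lemma ip_continuous u : continuous (ip u).
Proof.
apply: (@bounded_linear_continuous R H R^o (ip u)).
apply/linear_boundedP; near=> r => v; apply: (le_trans (norm_ip_le _ _)).
by apply: ler_wpM2r => //; near: r; exact: nbhs_pinfty_ge.
Unshelve. all: by end_near. Qed.

Lemma convex_setP (D : set H) : convex_set D ->
  forall (t : R) u v, 0 <= t -> t <= 1 -> D u -> D v -> D (t *: u + (1 - t) *: v).
Proof.
move=> Dconv t u v t0 t1 Du Dv.
have := Dconv u v (Itv01 t0 t1); rewrite !inE => /(_ Du Dv).
exact.
Qed.

Lemma convex_set_intro (D : set H) :
  (forall (t : R) u v, 0 <= t -> t <= 1 -> D u -> D v ->
    D (t *: u + (1 - t) *: v)) -> convex_set D.
Proof.
move=> h u v t; rewrite !inE => Du Dv; apply: h => //.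
Qed.

(** Moving from [p] towards [w] by a fraction [t] cannot bring the point closer to [u]; expand the
    square, divide by [t] and let [t] tend to 0. *)
Lemma nearest_point_var (D : set H) u p : convex_set D ->
  D p -> (forall w, D w -> `|u - p| <= `|u - w|) ->
  forall w, D w -> ip (u - p) (w - p) <= 0.
Proof.
move=> Dconv Dp pmin w Dw.
suff : 2 * ip (u - p) (w - p) <= 0 by lra.
apply: (@le0_of_le_scale _ _ (`|w - p| ^+ 2)) => t t0 t1.
have Dt := convex_setP Dconv (ltW t0) t1 Dw Dp.
have : `|u - p| ^+ 2 <= `|(u - p) - t *: (w - p)| ^+ 2.
  rewrite lerXn2r ?nnegrE //; apply: (le_trans (pmin _ Dt)).
  rewrite le_eqVlt; apply/orP; left; apply/eqP; congr `|_|.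
  by rewrite scalerBl scale1r scalerBr !opprD !opprK addrACA addrA addrAC -!addrA
    [_ - p]addrC addrA.
rewrite [leRHS]sqr_normB ipZr normrZ (gtr0_norm t0).
set a := ip _ _; set b := `|w - p|; set c := `|u - p|; move=> h.
have : t * (2 * a) <= t * (t * b ^+ 2) by nra.
by rewrite ler_pM2l.
Qed.

End InnerProduct.

(** * Projection, Riesz representation, weak limits along ultrafilters, Opial's argument *)

Section HilbertSpace.
Variables (R : realType) (H : completeNormedModType R) (ip : {dot H for idfun}).
Hypothesis ipE : induces_norm ip.
Implicit Types (u v w p : H) (D : set H).

(* By the parallelogram identity, near-minimizers of the distance to a convex
   set are close to each other. *)
Lemma nearly_nearest_dist D u (d e : R) v w : convex_set D ->
  (forall z, D z -> d <= `|u - z|) -> 0 <= d -> D v -> D w ->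
  `|u - v| <= d + e -> `|u - w| <= d + e ->
  `|v - w| ^+ 2 <= 8 * d * e + 4 * e ^+ 2.
Proof.
move=> Dconv dmin d0 Dv Dw uv uw.
have : d <= `|u - (2^-1 *: v + (1 - 2^-1) *: w)|.
  by apply: dmin; apply: convex_setP => //; lra.
have -> : u - (2^-1 *: v + (1 - 2^-1) *: w) = 2^-1 *: ((u - v) + (u - w)).
  rewrite (_ : 1 - 2^-1 = 2^-1 :> R); last lra.
  rewrite addrACA -opprD scalerBr -scalerDr; congr (_ - _).
  by rewrite -mulr2n -[u *+ 2]scaler_nat scalerA mulVf ?scale1r.
rewrite normrZ gtr0_norm; last by lra.
move=> mid.
have uv2 : `|u - v| ^+ 2 <= (d + e) ^+ 2.
  by rewrite lerXn2r ?nnegrE // (le_trans _ uv).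
have uw2 : `|u - w| ^+ 2 <= (d + e) ^+ 2.
  by rewrite lerXn2r ?nnegrE // (le_trans _ uw).
have mid2 : (2 * d) ^+ 2 <= `|(u - v) + (u - w)| ^+ 2.
  by rewrite lerXn2r ?nnegrE //; lra.
have -> : v - w = (u - w) - (u - v) by rewrite opprB [RHS]addrC subrKA.
move: uv2 uw2 mid2; rewrite (sqr_normD ipE (u - v)) (sqr_normB ipE (u - w)) (ipC ip (u - w)).
nra.
Qed.

(** A minimizing sequence is Cauchy by the preceding estimate; its limit stays in the closed set [D]
    and attains the infimum. *)
Lemma nearest_point D u : D !=set0 -> closed D -> convex_set D ->
  exists2 p, D p & forall w, D w -> `|u - p| <= `|u - w|.
Proof.
move=> D0 Dcl Dconv.
pose E := [set `|u - w| | w in D].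
have E0 : E !=set0 by case: D0 => w Dw; exists `|u - w|, w.
have Elb : has_lbound E by exists 0 => _ [w _ <-].
pose d := inf E.
have dmin z : D z -> d <= `|u - z| by move=> Dz; apply: ge_inf => //; exists z.
have d0 : 0 <= d by apply: lb_le_inf => // _ [w _ <-].
have ex n : exists w, D w /\ `|u - w| < d + n.+1%:R^-1.
  have [||_ [w Dw <-] wd] := @inf_adherent _ E n.+1%:R^-1 => //.
  by exists w.
have [q qP] := choice ex.
have near_d (e : R) : 0 < e -> \forall n \near \oo, `|u - q n| <= d + e.
  move=> e0; near=> n; have [_ /ltW] := qP n => /le_trans; apply.
  rewrite lerD2l ltW //; near: n; exact: (near_infty_natSinv_lt (PosNum e0)).
have : cauchy (q n @[n --> \oo]).
  apply: cauchy_exP => e e0.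
  (* Since [e' <= 1], the estimate [8 d e' + 4 e'^2] is at most [(8 d + 4) e']; the 5 in place of 4
     makes it strictly less than [e^2]. *)
  pose e' := Num.min 1 (e ^+ 2 / (8 * d + 5)).
  have e2 : 0 < e ^+ 2 by rewrite exprn_gt0.
  have d5 : 0 < 8 * d + 5 by lra.
  have e'0 : 0 < e' by rewrite lt_min ltr01 divr_gt0.
  have e'1 : e' <= 1 by rewrite ge_min lexx.
  have e'2 : e' * (8 * d + 5) <= e ^+ 2.
    by rewrite -ler_pdivlMr // ge_min lexx orbT.
  have [N _ NP] := near_d _ e'0.
  exists (q N); change (\forall n \near \oo, ball (q N) e (q n)).
  near=> n; rewrite -ball_normE /=.
  rewrite -(ltr_pXn2r (ltn0Sn 1)) ?nnegrE ?(ltW e0) //.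
  have [DN _] := qP N; have [Dn _] := qP n.
  have qn : `|u - q n| <= d + e' by apply: NP; near: n; exact: nbhs_infty_ge.
  have := nearly_nearest_dist Dconv dmin d0 DN Dn (NP _ (leqnn N)) qn.
  move=> /le_lt_trans; apply; nra.
move=> /cauchy_cvg /cvg_ex [p qp]; exists p.
  by apply: (closed_cvg D Dcl _ p qp); apply: nearW => n; case: (qP n).
move=> w Dw; apply: (le_trans _ (dmin _ Dw)); apply/ler_addgt0Pr => e e0.
have dp : `|u - q n| @[n --> \oo] --> `|u - p|.
  by apply: cvg_norm; apply: cvgB => //; exact: cvg_cst.
exact: (cvgr_to_le dp (near_d _ e0)).
Unshelve. all: by end_near. Qed.

Lemma metric_projP D u : D !=set0 -> closed D -> convex_set D ->
  D (metric_proj D u) /\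
  forall w, D w -> ip (u - metric_proj D u) (w - metric_proj D u) <= 0.
Proof.
move=> D0 Dcl Dconv; have [p Dp pmin] := nearest_point u D0 Dcl Dconv.
(* The default value of [xget] is excluded by the existence of [p]. *)
rewrite /metric_proj; case: xgetP => [q _ [Dq qmin]|/(_ p)]; last by case.
by split=> //; exact: nearest_point_var.
Qed.

(** For nonzero [f], the point [p] of the hyperplane [f = 1] nearest to the origin is orthogonal to
    the kernel of [f], and a multiple of it represents [f]. *)
Lemma riesz (f : {linear H -> R^o}) : continuous f ->
  exists a, forall u, f u = ip a u.
Proof.
move=> fc.
have [f0|/existsNP[x0 /eqP fx0]] := pselect (forall u, f u = 0).
  by exists 0 => u; rewrite f0 linear0l.
have fZ a u : f (a *: u) = a * f u by rewrite linearZ.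
pose D : set H := [set u | f u = 1].
have Dconv : convex_set D.
  apply: convex_set_intro => t u v _ _ /= fu fv.
  by rewrite /D /= linearD !fZ fu fv !mulr1 addrC subrK.
have [||//|p Dp pmin] := @nearest_point D 0.
- by exists ((f x0)^-1 *: x0); rewrite /D /= fZ mulVf.
- by apply: (@closed_comp _ _ f [set 1]) => [u _|]; [exact: fc|exact: closed_eq].
(* Both [p + h] and [p - h] lie in the hyperplane, so the variational inequality bounds [ip p h]
   from both sides. *)
have pker h : f h = 0 -> ip p h = 0.
  move=> fh.
  have D1 : D (p + h) by rewrite /D /= linearD fh addr0.
  have D2 : D (p - h) by rewrite /D /= linearB fh subr0.
  have := nearest_point_var ipE Dconv Dp pmin D1.
  have := nearest_point_var ipE Dconv Dp pmin D2.
  rewrite !ip_linE !linear0l => h1 h2.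
  by lra.
have pp : ip p p != 0.
  apply/eqP => /(ip_eq0_norm ipE) p0; move: Dp; rewrite /D /= p0 linear0.
  by move/eqP; rewrite eq_sym oner_eq0.
exists ((ip p p)^-1 *: p) => u; rewrite ipZl.
have := pker (u - f u *: p); rewrite linearB fZ Dp mulr1 subrr.
move=> /(_ erefl); rewrite !ip_linE => /eqP; rewrite subr_eq0 => /eqP ->.
by rewrite mulrCA mulVf ?mulr1.
Qed.

(** Compactness of [[-B, B]] gives a cluster point, and an ultrafilter converges to any of its
    cluster points. *)
Lemma ultrafilter_bounded_cvg (U : set_system nat) (s : nat -> R) (B : R) :
  UltraFilter U -> (forall n, `|s n| <= B) -> cvg (s n @[n --> U]).
Proof.
move=> UU sB.
have [a [_ ca]] : `[- B, B] `&` cluster (s n @[n --> U]) !=set0.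
  apply: (@segment_compact R).
  by apply: nearW => n; rewrite /= in_itv /= -ler_norml.
apply/cvg_ex; exists a => A nA; have [//|UA] := in_ultra_setVsetC (s @^-1` A) UU.
by have [z [/= nAz Az]] := ca (~` A) A UA nA.
Qed.

(** Weak compactness of balls: the pointwise limit of [h |-> ip (x n) h] along [U] is linear and
    bounded by [B], hence represented by a vector. *)
Lemma weak_ultralimit (U : set_system nat) (x : nat -> H) (B : R) :
  UltraFilter U -> (forall n, `|x n| <= B) ->
  exists p, forall h, ip (x n) h @[n --> U] --> ip p h.
Proof.
move=> UU xB.
have B0 : 0 <= B by rewrite (le_trans _ (xB 0%N)).
have bnd h n : `|ip (x n) h| <= B * `|h|.
  by apply: (le_trans (norm_ip_le ipE _ _)); rewrite ler_wpM2r.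
pose phi h : R^o := lim (ip (x n) h @[n --> U]).
have phiP h : ip (x n) h @[n --> U] --> phi h.
  exact: (ultrafilter_bounded_cvg UU (bnd h)).
have phi_lin : linear phi.
  move=> a u v; apply: cvg_lim => //.
  under eq_fun do rewrite ipDr ipZr.
  by apply: cvgD => //; apply: cvgMr.
pose lphi := GRing.isLinear.Build R H R^o _ phi phi_lin.
pose f : {linear H -> R^o} := HB.pack phi lphi.
have [|a aP] := @riesz f.
  apply: bounded_linear_continuous; apply/linear_boundedP; near=> r => h.
  apply: (@le_trans _ _ (B * `|h|)).
    apply: (cvgr_to_le (cvg_norm (phiP h))); exact: nearW.
  by apply: ler_wpM2r => //; near: r; exact: nbhs_pinfty_ge.
by exists a => h; rewrite -aP; exact: phiP.
Unshelve. all: by end_near. Qed.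

(* Opial's argument, with ultrafilters in place of weakly convergent
   subsequences. *)
Lemma opial (S : set H) (x : nat -> H) : S !=set0 ->
  (forall p, S p -> cvgn (fun n => `|x n - p|)) ->
  (forall (U : set_system nat) p, UltraFilter U -> \oo `<=` U ->
    (forall h, ip (x n) h @[n --> U] --> ip p h) -> S p) ->
  exists2 p, S p & weakly_cvg x p.
Proof.
move=> [s Ss] xcv Scl.
have [B xB] : exists B, forall n, `|x n| <= B.
  have /cvg_seq_bounded/ex_strict_bound_gt0[M _ MP] : cvgn (fun n => `|x n - s| : R^o).
    exact: xcv.
  exists (M + `|s|) => n; have := MP n Logic.I; rewrite /= normr_id => /ltW h.
  by rewrite -(subrK s (x n)) (le_trans (ler_normD _ _)) // lerD2r.
have wk U : UltraFilter U -> \oo `<=` U ->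
    exists2 p, S p & forall h, ip (x n) h @[n --> U] --> ip p h.
  move=> UU sU; have [p pP] := weak_ultralimit UU xB.
  by exists p => //; exact: (Scl U).
have [U0 [UU0 sU0]] := ultraFilterLemma (F := \oo) _.
have [p Sp pP] := wk _ UU0 sU0; exists p => // f fc.
have [a aP] := riesz fc.
move=> A nA; apply: contrapT => nUA.
(* If weak convergence fails at the neighbourhood [A], the indices with [f (x n)] outside [A] meet
   every tail, so some ultrafilter finer than [\oo] contains them. *)
pose F := within (~` [set n | A (f (x n))]) \oo.
have FF : ProperFilter F.
  split; last exact: within_filter.
  by rewrite /F /within /= => h; apply: nUA; apply: filterS h => n /= /contrapT.
have [U1 [UU1 sU1]] := ultraFilterLemma FF.
have sFU : \oo `<=` U1 by move=> Z nZ; apply: sU1; apply: filterS nZ => n Zn _.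
have [q Sq qP] := wk _ UU1 sFU.
have := xcv _ Sp; have := xcv _ Sq => /cvg_ex[/= b bP] /cvg_ex[/= c cP].
(* The difference of the squared distances to [p] and [q] is affine in [x n]; hence this product
   converges along the whole sequence, and both ultrafilters see the same limit [l]. *)
have : ip (x n) (p - q) @[n --> \oo] -->
    (2^-1 * (b ^+ 2 - c ^+ 2 + `|p| ^+ 2 - `|q| ^+ 2)).
  have -> : (fun n => ip (x n) (p - q)) = (fun n => 2^-1 *
      (`|x n - q| ^+ 2 - `|x n - p| ^+ 2 + `|p| ^+ 2 - `|q| ^+ 2)).
    apply/funext => n; rewrite !(sqr_normB ipE) ipDr ipNr; by field.
  apply: cvgM; first exact: cvg_cst.
  apply: cvgB; last exact: cvg_cst.
  apply: cvgD; last exact: cvg_cst.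
  by apply: cvgB; [exact: (cvgM bP bP)|exact: (cvgM cP cP)].
set l := (2^-1 * _) => ll.
have pl : ip p (p - q) = l.
  apply: (cvg_unique _ (pP _)) => //; exact: (cvg_trans (cvg_app _ sU0) ll).
have ql : ip q (p - q) = l.
  apply: (cvg_unique _ (qP _)) => //; exact: (cvg_trans (cvg_app _ sFU) ll).
have pq : p = q.
  apply/eqP; rewrite -subr_eq0; apply/eqP/(ip_eq0_norm ipE).
  by rewrite ipDl ipNl pl ql subrr.
(* As [q = p], the ultrafilter [U1] contains both the index set of [A] and its complement, which is
   absurd. *)
have UA : U1 [set n | A (f (x n))].
  have := qP a; rewrite -pq => /(_ A); rewrite [ip p a]ipC -aP => /(_ nA).
  by rewrite /= /nbhs /=; under eq_fun do rewrite ipC -aP.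
have UnA : U1 (~` [set n | A (f (x n))]) by apply: sU1; exact: withinT.
by have [n []] := filter_ex (filterI UA UnA).
Qed.

End HilbertSpace.

(** * A single step: Minty's inequality, the half-space, the line search and the descent estimate *)

Section Step.
Variables (R : realType) (H : completeNormedModType R) (ip : {dot H for idfun}).
Hypothesis ipE : induces_norm ip.
Variables (C : set H) (C0 : C !=set0) (C_closed : closed C)
  (C_convex : convex_set C).
Variable F : H -> H.
Hypothesis F_monotone : monotone_map ip F.
Variable L : R.
Hypotheses (L_gt0 : 0 < L) (F_lipschitz : L.-lipschitz F).
Implicit Types (u v w z p : H) (gamma : R).

Lemma lipschitz_norm u w : `|F u - F w| <= L * `|u - w|.
Proof. exact: (F_lipschitz (x := (u, w))). Qed.

(** Test the hypothesis at [u = p + t (w - p)], divide by [t], replace [F u] by [F p] at a Lipschitz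
    cost of order [t], and let [t] tend to 0. *)
Lemma minty p : C p -> (forall u, C u -> 0 <= ip (F u) (u - p)) -> SOL ip C F p.
Proof.
move=> Cp h; split=> // w Cw.
rewrite -oppr_le0; apply: (@le0_of_le_scale _ _ (L * `|w - p| ^+ 2)) => t t0 t1.
have := h _ (convex_setP C_convex (ltW t0) t1 Cw Cp).
have upE : t *: w + (1 - t) *: p - p = t *: (w - p).
  by rewrite scalerBl scale1r scalerBr addrA addrAC addrK.
set u := t *: w + (1 - t) *: p in upE *; rewrite upE ipZr pmulr_rge0 // => h1.
have := ip_le_norm ipE (F u - F p) (w - p).
have := ler_wpM2r (normr_ge0 (w - p)) (lipschitz_norm u p).
rewrite upE normrZ (gtr0_norm t0) ipDl ipNl => h2 h3.
have -> : t * (L * `|w - p| ^+ 2) = L * (t * `|w - p|) * `|w - p| by ring.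
lra.
Qed.

Lemma extragrad_yP z gamma : let y := extragrad_y C F z gamma in
  C y /\ forall w, C w -> ip (z - gamma *: F z - y) (w - y) <= 0.
Proof. exact: metric_projP. Qed.

(** The set contains [y] and is a closed convex sublevel set of a continuous affine function, so the
    projection onto it is genuine. *)
Lemma halfspace_projP z gamma u :
  let T := subgrad_halfspace ip C F z gamma in
  let q := metric_proj T u in
  T q /\ forall w, T w -> ip (u - q) (w - q) <= 0.
Proof.
move=> T; have [Cy yP] := extragrad_yP z gamma.
apply: metric_projP => //.
- by exists (extragrad_y C F z gamma); rewrite /T /subgrad_halfspace /= subrr linear0r.
- rewrite /T /subgrad_halfspace /=; set y := extragrad_y _ _ _ _.
  apply: (@closed_comp _ _ (fun w => ip (z - gamma *: F z - y) (w - y))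
    [set r : R | r <= 0]); last exact: closed_le.
  move=> w _; apply: (@continuous_comp _ _ _ (fun w => w - y)).
    by apply: cvgB; [exact: cvg_id|exact: cvg_cst].
  exact: (ip_continuous ipE).
- apply: convex_set_intro => t u1 u2 t0 t1; rewrite /T /subgrad_halfspace /=.
  set y := extragrad_y _ _ _ _; set d := _ - y.
  have -> : t *: u1 + (1 - t) *: u2 - y = t *: (u1 - y) + (1 - t) *: (u2 - y).
    rewrite !scalerBr addrACA -opprD -scalerDl.
    by rewrite (_ : t + (1 - t) = 1) ?scale1r //; ring.
  by move=> h1 h2; rewrite ipDr !ipZr -[leRHS]addr0 lerD // mulr_ge0_le0 // subr_ge0.
Qed.

(** The Lipschitz bound gives [mu |z - y|] on the left, and [z] differs from [x] by [lambda v]. *)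
Lemma linesearch_test_small mu x v lambda gamma : 0 <= lambda -> 0 <= gamma ->
  gamma * L <= mu -> linesearch_test C F mu x v lambda gamma.
Proof.
move=> l0 g0 gL; rewrite /linesearch_test.
set z := x + _; set y := extragrad_y _ _ _ _.
have zy : `|z - y| <= `|x - y| + lambda * `|v|.
  by rewrite /z addrAC (le_trans (ler_normD _ _)) // lerD2l normrZ ger0_norm.
have := ler_wpM2l g0 (lipschitz_norm z y); rewrite mulrA => /le_trans; apply.
by apply: ler_pM; rewrite ?mulr_ge0 // ltW.
Qed.

(* The trial step size before the accepted one failed the test, hence exceeds
   [mu / L]. *)
Lemma linesearch_ge sigma rho mu x v lambda m : 0 < sigma -> 0 < rho ->
  0 < mu -> 0 <= lambda ->
  (forall n, linesearch_test C F mu x v lambda (sigma * rho ^+ n) ->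
    (m <= n)%N) ->
  Num.min sigma (rho * mu / L) <= sigma * rho ^+ m.
Proof.
move=> s0 r0 m0 l0; case: m => [|m] mmin; first by rewrite expr0 mulr1 ge_min lexx.
have [gL|gL] := leP (sigma * rho ^+ m * L) mu.
  suff /mmin : linesearch_test C F mu x v lambda (sigma * rho ^+ m) by rewrite ltnn.
  by apply: linesearch_test_small => //; rewrite mulr_ge0 ?exprn_ge0 // ltW.
rewrite ge_min; apply/orP; right; rewrite ler_pdivrMr // exprS.
by rewrite mulrCA -!mulrA ler_pM2l // mulrA ltW.
Qed.

(* The error term comes from [4 b e <= c b^2 + 4 e^2 / c] with [b = |x' - y|]
   and [c = 1 - mu]. *)
Lemma extragrad_descent mu gamma z p (e : R) : 0 < mu -> mu < 1 -> 0 < gamma ->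
  0 <= e -> SOL ip C F p ->
  let y := extragrad_y C F z gamma in
  let x' := metric_proj (subgrad_halfspace ip C F z gamma) (z - gamma *: F y) in
  gamma * `|F z - F y| <= mu * (`|z - y| + 2 * e) ->
  `|x' - p| ^+ 2 + (1 - mu) * `|z - y| ^+ 2
    <= `|z - p| ^+ 2 + 4 / (1 - mu) * e ^+ 2.
Proof.
move=> mu0 mu1 g0 e0 [Cp solp] y x' test.
have [Cy yP] := extragrad_yP z gamma.
have [Tx xP] := halfspace_projP z gamma (z - gamma *: F y).
(* The solution [p] lies in the half-space because the projection inequality for [y] puts all of [C]
   there. *)
have xp : ip (z - gamma *: F y - x') (p - x') <= 0 by apply: xP; exact: yP.
have Tx' : ip (z - gamma *: F z - y) (x' - y) <= 0 by exact: Tx.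
have sol_y : 0 <= ip (F y) (y - p).
  have := F_monotone y p; rewrite ipDl ipNl.
  have := solp _ Cy; lra.
have cs : gamma * ip (F z - F y) (x' - y) <= mu * (`|z - y| + 2 * e) * `|x' - y|.
  apply: (@le_trans _ _ (gamma * `|F z - F y| * `|x' - y|)).
    by rewrite -mulrA ler_wpM2l ?(ltW g0) // ip_le_norm.
  by rewrite ler_wpM2r.
have {sol_y}: 0 <= gamma * ip (F y) (y - p) by rewrite mulr_ge0 // ltW.
(* An exact expansion: the first three terms on the right are nonnegative, and only the last one
   needs the line search bound [cs]. *)
have E : `|z - p| ^+ 2 - `|x' - p| ^+ 2 - `|z - y| ^+ 2 - `|x' - y| ^+ 2 =
    2 * (gamma * ip (F y) (y - p)) - 2 * ip (z - gamma *: F y - x') (p - x')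
    - 2 * ip (z - gamma *: F z - y) (x' - y)
    - 2 * (gamma * ip (F z - F y) (x' - y)).
  rewrite !ipE !ip_linE (ipC ip y x') (ipC ip p x') (ipC ip p z) (ipC ip y z).
  ring.
have c0 : 0 < 1 - mu by lra.
have amgm : 4 * `|x' - y| * e <= (1 - mu) * `|x' - y| ^+ 2 + 4 / (1 - mu) * e ^+ 2.
  have -> : 4 / (1 - mu) * e ^+ 2 = (2 * e) ^+ 2 / (1 - mu).
    by field; rewrite gt_eqF.
  have : 0 <= ((1 - mu) * `|x' - y| - 2 * e) ^+ 2 / (1 - mu).
    by rewrite divr_ge0 ?sqr_ge0 // ltW.
  have -> : ((1 - mu) * `|x' - y| - 2 * e) ^+ 2 / (1 - mu) =
     (1 - mu) * `|x' - y| ^+ 2 - 4 * `|x' - y| * e + (2 * e) ^+ 2 / (1 - mu).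
    by field; rewrite gt_eqF.
  lra.
have sq : 2 * (`|z - y| * `|x' - y|) <= `|z - y| ^+ 2 + `|x' - y| ^+ 2.
  have := sqr_ge0 (`|z - y| - `|x' - y|); rewrite sqrrB -mulr_natl; lra.
have muxe : mu * (`|x' - y| * e) <= `|x' - y| * e.
  by rewrite ler_piMl ?mulr_ge0 // ltW.
have musq := ler_wpM2l (ltW mu0) sq.
move: E xp Tx' cs amgm muxe musq; lra.
Qed.

End Step.

(** * Convergence of real sequences *)

(** Subtracting the partial sums of [b] from [a] leaves a nonincreasing sequence that is bounded
    below. *)
Lemma quasi_fejer_cvg (R : realType) (a b : nat -> R) :
  (forall n, 0 <= a n) -> cvgn (series b) ->
  (forall n, a n.+1 <= a n + b n) -> cvgn a.
Proof.
move=> a0 bcv ab.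
have /cvg_seq_bounded/ex_strict_bound_gt0[M _ MP] : cvgn (series b : nat -> R^o).
  exact: bcv.
have dcv : cvgn (a \- series b).
  apply: nonincreasing_is_cvgn.
    apply/nonincreasing_seqP => n; rewrite /= /series /= big_nat_recr //=.
    have := ab n; lra.
  exists (- M) => _ [n _ <-] /=; have := a0 n.
  have := MP n Logic.I; rewrite /= => /ltW; rewrite ler_norml => /andP[_]; lra.
have -> : a = (a \- series b) \+ series b by apply/funext => n /=; rewrite subrK.
exact: is_cvgD.
Qed.

Lemma cvg_sqr_le0 (R : realType) (d s : nat -> R) : (forall n, 0 <= d n) ->
  (forall n, d n ^+ 2 <= s n) -> s n @[n --> \oo] --> 0 ->
  d n @[n --> \oo] --> 0.
Proof.
move=> d0 ds s0.
apply: (@squeeze_cvgr _ _ _ _ (fun=> 0) (fun n => Num.sqrt (s n))).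
- apply: nearW => n; rewrite d0 /= -[leLHS]ger0_norm // -sqrtr_sqr.
  by rewrite ler_wsqrtr.
- exact: cvg_cst.
- by rewrite -[X in _ --> X]sqrtr0; apply: continuous_cvg => //; exact: sqrt_continuous.
Qed.

(** * Asymptotic behaviour of the generated sequence *)

Section Method.
Variables (R : realType) (H : completeNormedModType R) (ip : {dot H for idfun}).
Hypothesis ipE : induces_norm ip.
Variables (C : set H) (C0 : C !=set0) (C_closed : closed C)
  (C_convex : convex_set C).
Variable F : H -> H.
Hypothesis F_monotone : monotone_map ip F.
Variable L : R.
Hypotheses (L_gt0 : 0 < L) (F_lipschitz : L.-lipschitz F).

(** The projection inequality bounds [ip (F z) (u - y)] from below, the Lipschitz bound passes from
    [F z] to [F y], and monotonicity from [F y] to [F u]. Using [gmin] makes the constant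
    independent of the step. *)
Lemma extragrad_approx_sol gamma gmin z u : 0 < gmin -> gmin <= gamma ->
  let y := extragrad_y C F z gamma in C u ->
  - ((gmin^-1 + L) * `|z - y| * `|u - y|) <= ip (F u) (u - y).
Proof.
move=> gm0 gm y Cu.
have g0 : 0 < gamma := lt_le_trans gm0 gm.
have [_ yP] := extragrad_yP ipE C0 C_closed C_convex F z gamma.
have zy : ip (z - y) (u - y) <= gamma * ip (F z) (u - y).
  by have := yP _ Cu; rewrite -/y addrAC ipDl ipNl ipZl; lra.
have lo : - (gmin^-1 * `|z - y| * `|u - y|) <= ip (F z) (u - y).
  rewrite -(ler_pM2l g0) (le_trans _ zy) //.
  have := norm_ip_le ipE (z - y) (u - y); rewrite ler_norml => /andP[h _].
  apply: (le_trans _ h); rewrite mulrN lerN2 -!mulrA [gamma * _]mulrA.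
  by rewrite ler_peMl ?mulr_ge0 // ler_pdivlMr ?mul1r.
have Lip : - (L * `|z - y| * `|u - y|) <= ip (F y - F z) (u - y).
  have := norm_ip_le ipE (F y - F z) (u - y); rewrite ler_norml => /andP[h _].
  apply: (le_trans _ h); rewrite lerN2 ler_wpM2r // distrC.
  exact: lipschitz_norm.
have mon := F_monotone u y.
move: lo Lip mon; rewrite !ipDl !ipNl !mulrDl; lra.
Qed.

(** The sequence [y] inherits the weak limit of [x]. In the approximate Minty inequality [F] is
    evaluated at the fixed point [u], so weak convergence suffices to pass to the limit. *)
Lemma weak_cluster_SOL (U : set_system nat) (x y : nat -> H) p :
  ProperFilter U -> (forall n, C (y n)) ->
  (forall h, ip (x n) h @[n --> U] --> ip p h) ->
  `|x n - y n| @[n --> U] --> 0 ->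
  (forall u, C u -> exists2 e : nat -> R, e n @[n --> U] --> 0 &
    forall n, - e n <= ip (F u) (u - y n)) ->
  SOL ip C F p.
Proof.
move=> UP Cy xp xy approx.
have yp h : ip (y n) h @[n --> U] --> ip p h.
  have -> : (fun n => ip (y n) h) = (fun n => ip (x n) h - ip (x n - y n) h).
    by apply/funext => n; rewrite ipDl ipNl opprB addrC subrK.
  rewrite -[ip p h]subr0; apply: cvgB => //.
  apply: norm_cvg0.
  apply: (@squeeze_cvgr _ _ _ _ (fun=> 0) (fun n => `|x n - y n| * `|h|)).
  - by apply: nearW => n; rewrite normr_ge0 /= norm_ip_le.
  - exact: cvg_cst.
  - by rewrite -(mul0r `|h|); apply: cvgM => //; exact: cvg_cst.
(* [C] is weakly closed: with [q] the projection of [p], the inequality [ip (p - q) (y n - q) <= 0]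
   passes to the limit and forces [p = q]. *)
have Cp : C p.
  have [CP PP] := metric_projP ipE p C0 C_closed C_convex.
  set q := metric_proj C p in CP PP *.
  suff /(ip_eq0_norm ipE)/eqP : ip (p - q) (p - q) = 0.
    by rewrite subr_eq0 => /eqP ->.
  apply/eqP; rewrite eq_le -{2}ipE sqr_ge0 andbT.
  apply: (@cvgr_to_le _ U _ _ (fun n => ip (p - q) (y n - q))).
    rewrite ipDr; under eq_fun do rewrite ipDr.
    apply: cvgD; last exact: cvg_cst.
    by under eq_fun do rewrite ipC; rewrite ipC; exact: yp.
  by apply: nearW => n; exact: PP.
apply: (minty ipE C_convex F_lipschitz Cp) => u Cu.
have [e e0 eP] := approx u Cu.
rewrite -oppr_le0 -oppr0.
apply: (@ler_cvg_to _ U _ _ (fun n => - ip (F u) (u - y n)) e) => //.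
- apply: cvgN; rewrite ipDr; under eq_fun do rewrite ipDr.
  apply: cvgD; first exact: cvg_cst.
  by under eq_fun do rewrite ipNr ipC; rewrite ipNr ipC; apply: cvgN; exact: yp.
- by rewrite oppr0.
- by apply: nearW => n; rewrite lerNl.
Qed.

Variables (sigma rho mu : R).
Hypotheses (sigma_gt0 : 0 < sigma) (rho_gt0 : 0 < rho)
  (mu_gt0 : 0 < mu) (mu_lt1 : mu < 1).
Variables (v : nat -> H) (lambda : nat -> R) (x : nat -> H).
Hypothesis lambda_ge0 : forall k, 0 <= lambda k.
Hypothesis x_generated : forall k, perturbed_subgrad_extragrad_step ip C F
  sigma rho mu (x k) (v k) (lambda k) (x k.+1).

Let z k := x k + lambda k *: v k.
Let e k := lambda k * `|v k|.

Let e_ge0 k : 0 <= e k.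
Proof. by rewrite mulr_ge0. Qed.

(** A single choice of step sizes must serve both the lower bound and the descent inequality, hence
    one existential over [gamma]. *)
Lemma method_stepP : exists2 gamma : nat -> R,
  (forall k, Num.min sigma (rho * mu / L) <= gamma k) &
  (forall k p, SOL ip C F p ->
    `|x k.+1 - p| ^+ 2 + (1 - mu) * `|z k - extragrad_y C F (z k) (gamma k)| ^+ 2
      <= (`|x k - p| + e k) ^+ 2 + 4 / (1 - mu) * e k ^+ 2).
Proof.
have [m mP] := choice x_generated.
exists (fun k => sigma * rho ^+ m k) => k.
  have [_ mmin _] := mP k.
  exact: (linesearch_ge L_gt0 F_lipschitz _ _ _ (lambda_ge0 k) mmin).
move=> p solp; have [test _ ->] := mP k.
rewrite -/(z k); set y := extragrad_y _ _ _ _.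
have zx w : `|z k - w| <= `|x k - w| + e k.
  by rewrite /z addrAC (le_trans (ler_normD _ _)) // lerD2l normrZ ger0_norm.
have xz w : `|x k - w| <= `|z k - w| + e k.
  rewrite -[x k](addrK (lambda k *: v k)) -/(z k) addrAC.
  by rewrite (le_trans (ler_normB _ _)) // lerD2l normrZ ger0_norm.
have g0 : 0 < sigma * rho ^+ m k by rewrite mulr_gt0 ?exprn_gt0.
(* One [e k] comes from the test itself, the other from replacing [x k] by [z k]. *)
have test' : sigma * rho ^+ m k * `|F (z k) - F y| <= mu * (`|z k - y| + 2 * e k).
  move: test; rewrite /linesearch_test -/(z k) -/y -/(e k) => /le_trans; apply.
  by rewrite ler_pM2l // mulr_natl mulr2n addrA lerD2r.
apply: (le_trans (extragrad_descent ipE C0 C_closed C_convex F_monotone mu_gt0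
  mu_lt1 g0 (e_ge0 k) solp test')).
by rewrite lerD2r lerXn2r ?nnegrE ?addr_ge0.
Qed.

Lemma method_dist_cvg p : cvgn (series e) -> SOL ip C F p ->
  cvgn (fun k => `|x k - p|).
Proof.
move=> ecv solp; have [gamma _ gP] := method_stepP.
have c0 : 0 < 1 - mu by rewrite subr_gt0.
(* With [b = 1 / (1 - mu)], the factor [1 + 2 b] makes the square of [r + (1 + 2 b) e_k] dominate
   [(r + e_k)^2 + 4 b e_k^2], so the descent inequality holds without squares. *)
apply: (@quasi_fejer_cvg _ _ (fun k => (1 + 2 / (1 - mu)) * e k)) => //.
  rewrite (_ : series _ = (fun n => (1 + 2 / (1 - mu)) * series e n)).
    exact: is_cvgMr.
  by apply/funext => n; rewrite /series /= mulr_sumr.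
move=> k; have := gP k p solp; set d := `|z k - _|; set r := `|x k - p|.
have r0 : 0 <= r by exact: normr_ge0.
have k0 : 0 < (1 - mu)^-1 by rewrite invr_gt0.
have k1 : 1 <= (1 - mu)^-1 by rewrite -[leLHS]invr1 lef_pV2 ?posrE // gerBl ltW.
have ek := e_ge0 k.
have b0 : 0 <= 1 + 2 / (1 - mu) by lra.
move=> h; rewrite -(ler_pXn2r (ltn0Sn 1)) ?nnegrE ?addr_ge0 ?mulr_ge0 //.
have dd : 0 <= (1 - mu) * d ^+ 2 by rewrite mulr_ge0 ?sqr_ge0 // ltW.
move: h; set b := (1 - mu)^-1 in k0 k1 *; move=> h.
have b2 : b * e k ^+ 2 <= b ^+ 2 * e k ^+ 2.
  by rewrite ler_wpM2r ?sqr_ge0 // expr2 ler_peMl // ltW.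
have re : 0 <= b * r * e k by rewrite !mulr_ge0 // ltW.
have be : 0 <= b * e k ^+ 2 by rewrite mulr_ge0 ?sqr_ge0 // ltW.
have -> : (r + (1 + 2 * b) * e k) ^+ 2 = (r + e k) ^+ 2
  + 4 * (b * r * e k) + 4 * (b * e k ^+ 2) + 4 * (b ^+ 2 * e k ^+ 2) by ring.
lra.
Qed.

(** The descent inequality bounds the squared residual by a multiple of a difference whose terms
    have the same limit [r^2], up to errors tending to 0. *)
Lemma method_residual_cvg p : cvgn (series e) -> SOL ip C F p ->
  forall gamma : nat -> R,
  (forall k, `|x k.+1 - p| ^+ 2
      + (1 - mu) * `|z k - extragrad_y C F (z k) (gamma k)| ^+ 2
      <= (`|x k - p| + e k) ^+ 2 + 4 / (1 - mu) * e k ^+ 2) ->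
  `|z k - extragrad_y C F (z k) (gamma k)| @[k --> \oo] --> 0.
Proof.
move=> ecv solp gamma gP.
have c0 : 0 < 1 - mu by rewrite subr_gt0.
have e0 : e k @[k --> \oo] --> 0 := cvg_series_cvg_0 ecv.
have /cvg_ex[/= r rP] := method_dist_cvg ecv solp.
have rSP : `|x k.+1 - p| @[k --> \oo] --> r.
  by move: rP; rewrite -(cvg_shiftS (fun k => `|x k - p|)).
apply: (@cvg_sqr_le0 _ _ (fun k => (1 - mu)^-1 * ((`|x k - p| + e k) ^+ 2
   + 4 / (1 - mu) * e k ^+ 2 - `|x k.+1 - p| ^+ 2))) => [k //|k|].
  by rewrite ler_pdivlMl //; have := gP k; lra.
have -> : 0 = (1 - mu)^-1 * ((r + 0) * (r + 0) + 4 / (1 - mu) * (0 * 0) - r * r).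
  ring.
apply: cvgM; first exact: cvg_cst.
apply: cvgB; last by apply: cvgM.
apply: cvgD; first by apply: cvgM; apply: cvgD.
by apply: cvgM; [exact: cvg_cst|apply: cvgM].
Qed.

End Method.

(** * Assembly: summable perturbations, vanishing residuals and weak limits of the iterates *)

Theorem theorem5p7 (R : realType) (H : completeNormedModType R)
    (ip : {dot H for idfun}) (ipE : induces_norm ip)
    (C : set H) (C_nonempty : C !=set0) (C_closed : closed C)
    (C_convex : convex_set C)
    (F : H -> H) (SOL_nonempty : SOL ip C F !=set0)
    (F_monotone : monotone_map ip F)
    (L : R) (L_gt0 : 0 < L) (F_lipschitz : L.-lipschitz F)
    (sigma rho mu : R) (sigma_gt0 : 0 < sigma)
    (rho_gt0 : 0 < rho) (rho_lt1 : rho < 1)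
    (mu_gt0 : 0 < mu) (mu_lt1 : mu < 1)
    (v : nat -> H) (v_bounded : bounded_fun v)
    (lambda : nat -> R) (lambda_ge0 : forall k, 0 <= lambda k)
    (lambda_summable : (\sum_(0 <= k <oo) (lambda k)%:E < +oo)%E)
    (x : nat -> H)
    (x_generated : forall k, perturbed_subgrad_extragrad_step ip C F
       sigma rho mu (x k) (v k) (lambda k) (x k.+1)) :
  exists2 p, SOL ip C F p & weakly_cvg x p.
Proof.
pose e k := lambda k * `|v k|.
have ecv : cvgn (series e).
  (* A bound [M] on the vectors [v k] gives [e k <= M * lambda k], and summability follows by
     comparison. *)
  have [M _ MP] := ex_strict_bound_gt0 v_bounded.
  apply: (@series_le_cvg _ _ (fun k => M * lambda k)).
  - by move=> k; rewrite mulr_ge0.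
  - by move=> k; rewrite mulrC mulr_ge0 // (le_trans _ (ltW (MP 0%N Logic.I))).
  - by move=> k; rewrite /e mulrC ler_wpM2r // ltW // (MP k Logic.I).
  rewrite (_ : series _ = (fun n => M * series lambda n)).
    by apply: is_cvgMr; exact: nnseries_is_cvg.
  by apply/funext => n; rewrite /series /= mulr_sumr.
have dcv := method_dist_cvg ipE C_nonempty C_closed C_convex F_monotone L_gt0
  F_lipschitz sigma_gt0 rho_gt0 mu_gt0 mu_lt1 lambda_ge0 x_generated ecv.
(* It remains to show that every weak limit along an ultrafilter finer than [\oo] is a solution. *)
apply: (opial ipE SOL_nonempty dcv) => U p UU sU xp.
have [gamma gmin gP] := method_stepP ipE C_nonempty C_closed C_convex F_monotone
  L_gt0 F_lipschitz sigma_gt0 rho_gt0 mu_gt0 mu_lt1 lambda_ge0 x_generated.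
have [s sols] := SOL_nonempty.
pose z k := x k + lambda k *: v k.
pose y k := extragrad_y C F (z k) (gamma k).
have zy0 : `|z k - y k| @[k --> \oo] --> 0.
  exact (method_residual_cvg ipE C_nonempty C_closed C_convex F_monotone L_gt0
    F_lipschitz sigma_gt0 rho_gt0 mu_gt0 mu_lt1 lambda_ge0 x_generated ecv sols
    (fun k => gP k s sols)).
have xy0 : `|x k - y k| @[k --> \oo] --> 0.
  apply: (@squeeze_cvgr _ _ _ _ (fun=> 0) (fun k => `|z k - y k| + e k)).
  - apply: nearW => k; rewrite normr_ge0 /=.
    rewrite -[x k](addrK (lambda k *: v k)) -/(z k) addrAC.
    by rewrite (le_trans (ler_normB _ _)) // lerD2l normrZ ger0_norm.
  - exact: cvg_cst.
  - by rewrite -[X in _ --> X]addr0; apply: cvgD; [exact: zy0|exact: cvg_series_cvg_0 ecv].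
apply: (@weak_cluster_SOL _ _ _ ipE _ C_nonempty C_closed C_convex _ _ F_lipschitz
  U x y) => //.
- by move=> k; have [] := extragrad_yP ipE C_nonempty C_closed C_convex F
    (z k) (gamma k).
- exact: (cvg_trans (cvg_app _ sU) xy0).
move=> u Cu; pose g := Num.min sigma (rho * mu / L).
have g0 : 0 < g by rewrite lt_min sigma_gt0 divr_gt0 ?mulr_gt0.
have /cvg_ex[/= r rP] := dcv _ sols.
(* The last factor bounds [|u - y k|] by the triangle inequality through [s] and [x k]; it
   converges, so the vanishing residual drives [eps] to 0. *)
pose eps k := (g^-1 + L) * `|z k - y k| * (`|u - s| + `|x k - s| + `|x k - y k|).
exists eps.
  suff : eps k @[k --> \oo] --> 0 by move=> h; exact: (cvg_trans (cvg_app _ sU) h).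
  have -> : 0 = (g^-1 + L) * 0 * (`|u - s| + r + 0) by rewrite mulr0 mul0r.
  apply: cvgM; first by apply: cvgM => //; exact: cvg_cst.
  by apply: cvgD => //; apply: cvgD => //; exact: cvg_cst.
move=> k; have := extragrad_approx_sol ipE C_nonempty C_closed C_convex F_monotone
  F_lipschitz (z k) g0 (gmin k) Cu.
apply: le_trans; rewrite lerN2 /eps -/(y k) ler_wpM2l //.
  by rewrite mulr_ge0 // addr_ge0 ?invr_ge0 // ltW.
have -> : u - y k = (u - s) - (x k - s) + (x k - y k).
  by rewrite opprB !subrKA.
by rewrite (le_trans (ler_normD _ _)) // lerD2r ler_normB.
Qed.
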